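(* Let $\lambda$ be a nonzero real number. For every integer $n\ge 0$, as polynomials in $x$, $$B_{n,\lambda}(x)=\sum_{k=0}^{n}(-1)^{n-k}S_{2}(n,k)B_{k,\lambda}^{L}(x).$$
   Context: For $0\ne\lambda\in\mathbb{R}$, put $(x)_{0,\lambda}=1$ and $(x)_{n,\lambda}=x(x-\lambda)\cdots(x-(n-1)\lambda)$ for $n\ge 1$; the degenerate exponential function is $e_\lambda^x(t)=(1+\lambda t)^{x/\lambda}=\sum_{n=0}^\infty (x)_{n,\lambda}\frac{t^n}{n!}$. The degenerate Lah-Bell polynomials $B_{n,\lambda}^L(x)$ are defined by $e_\lambda^x\left(\frac{1}{1-t}-1\right)=\sum_{n=0}^\infty B_{n,\lambda}^L(x)\frac{t^n}{n!}$, and the degenerate Bell polynomials $B_{n,\lambda}(x)$ by $e_\lambda^x(e^t-1)=\sum_{n=0}^\infty B_{n,\lambda}(x)\frac{t^n}{n!}$ (formal power series in $t$). $S_2(n,k)$ is the Stirling number of the second kind: the number of ways to partition a set of $n$ elements into $k$ nonempty subsets. *)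

(* Defs.v *)
From mathcomp Require Import all_boot all_order all_algebra.
From mathcomp Require Import reals.

Set Implicit Arguments.
Unset Strict Implicit.
Unset Printing Implicit Defensive.

Import Order.TTheory GRing.Theory Num.Theory.
Local Open Scope ring_scope.

(* Formal power series in t over A: f stands for \sum_n (f n) t^n. *)
Definition fps (A : nzRingType) := nat -> A.

Section FormalPowerSeries.
Variable A : nzRingType.
Implicit Types f g : fps A.

Definition fps_const (a : A) : fps A := fun n => if n == 0%N then a else 0.

Definition fps_t : fps A := fun n => (n == 1%N)%:R.

Definition fps_sub f g : fps A := fun n => f n - g n.

Definition fps_mul f g : fps A := fun n => \sum_(i < n.+1) f i * g (n - i)%N.

Definition fps_pow f (k : nat) : fps A := iter k (fps_mul f) (fps_const 1).

(* f(g(t)) = \sum_k (f k) g(t)^k, meaningful only when g 0 = 0: then g(t)^k has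
   no term of degree < k, so the terms k > n do not contribute to the
   coefficient of t^n (see fps_comp_trunc). *)
Definition fps_comp f g : fps A :=
  fun n => \sum_(k < n.+1) f k * fps_pow g k n.

(* 1 / (1 - t), see fps_geomP. *)
Definition fps_geom : fps A := fun _ => 1.

Lemma fps_geomP :
  fps_mul (fps_sub (fps_const 1) fps_t) fps_geom =1 fps_const 1.
Proof.
move=> [|n]; rewrite /fps_mul /fps_sub /fps_const /fps_t /fps_geom /=.
  by rewrite big_ord_recl big_ord0 /= mulr1 subr0 addr0.
rewrite big_ord_recl big_ord_recl big1 => [|i _] /=.
  by rewrite !mulr1 addr0 subr0 sub0r subrr.
by rewrite mulr1 subr0.
Qed.

Lemma fps_pow_ord g k n : g 0%N = 0 -> (n < k)%N -> fps_pow g k n = 0.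
Proof.
move=> g0; elim: k n => // k IHk n lt_nk.
rewrite /fps_pow /= /fps_mul big_ord_recl g0 mul0r add0r big1 // => i _.
rewrite -/(fps_pow g k) IHk ?mulr0 // (leq_trans _ (lt_nk : (n <= k)%N)) //.
by rewrite ltn_subrL (leq_ltn_trans _ (ltn_ord i)).
Qed.

Lemma fps_comp_trunc f g m n : g 0%N = 0 -> (n < m)%N ->
  \sum_(k < m) f k * fps_pow g k n = fps_comp f g n.
Proof.
move=> g0 lt_nm; rewrite /fps_comp.
rewrite -!(big_mkord xpredT (fun k => f k * fps_pow g k n)).
rewrite (big_cat_nat (leq0n n.+1) lt_nm) /=.
rewrite [X in _ + X]big_nat [X in _ + X]big1 ?addr0 //.
by move=> k /andP[lt_nk _]; rewrite fps_pow_ord ?mulr0.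
Qed.

End FormalPowerSeries.

Section DegenerateBell.
Variable R : realType.

(* From here on the coefficients live in {poly R}, whose indeterminate 'X plays
   the role of x. *)

(* \sum_n (b n) t^n / n! *)
Definition egf (b : nat -> {poly R}) : fps {poly R} :=
  fun n => (n`!%:R^-1 : R) *: b n.

Definition degenerate_falling (lambda : R) (n : nat) : {poly R} :=
  \prod_(i < n) ('X - (i%:R * lambda)%:P).

(* e_lambda^x(t) = (1 + lambda t)^(x / lambda) *)
Definition degenerate_exp (lambda : R) : fps {poly R} :=
  egf (degenerate_falling lambda).

Definition fps_exp : fps {poly R} := egf (fun _ => 1).

Definition lah_bell_gf (lambda : R) : fps {poly R} :=
  fps_comp (degenerate_exp lambda)
           (fps_sub (fps_geom {poly R}) (fps_const 1)).

Definition bell_gf (lambda : R) : fps {poly R} :=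
  fps_comp (degenerate_exp lambda) (fps_sub fps_exp (fps_const 1)).

Definition degenerate_lah_bell (lambda : R) (n : nat) : {poly R} :=
  (n`!%:R : R) *: lah_bell_gf lambda n.

Definition degenerate_bell (lambda : R) (n : nat) : {poly R} :=
  (n`!%:R : R) *: bell_gf lambda n.

Lemma degenerate_lah_bellP lambda :
  lah_bell_gf lambda =1 egf (degenerate_lah_bell lambda).
Proof.
by move=> n; rewrite /egf scalerA mulVf ?scale1r // pnatr_eq0 -lt0n fact_gt0.
Qed.

Lemma degenerate_bellP lambda :
  bell_gf lambda =1 egf (degenerate_bell lambda).
Proof.
by move=> n; rewrite /egf scalerA mulVf ?scale1r // pnatr_eq0 -lt0n fact_gt0.
Qed.

Lemma lah_bell_inner0 :
  fps_sub (fps_geom {poly R}) (fps_const 1) 0%N = 0.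
Proof. by rewrite /fps_sub /fps_const /fps_geom /= subrr. Qed.

Lemma bell_inner0 : fps_sub fps_exp (fps_const 1) 0%N = 0.
Proof.
by rewrite /fps_sub /fps_const /fps_exp /egf /= fact0 invr1 scale1r subrr.
Qed.

End DegenerateBell.

(* mathcomp's [partition] already excludes the empty block. *)
Definition stirling2 (n k : nat) : nat :=
  #|[set P : {set {set 'I_n}} | partition P [set: 'I_n] & #|P| == k]|.

(* Main.v *)
Require Import Defs.
From mathcomp Require Import all_boot all_order all_algebra.
From mathcomp Require Import reals ring.
Import Order.TTheory GRing.Theory Num.Theory.

(** The inner series of the two generating functions are related by
    e^t - 1 = L(1 - e^(-t)), where L(t) = 1/(1 - t) - 1. Expanding the Lah-Bell
    generating function at 1 - e^(-t), whose k-th power is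
    k! \sum_n (-1)^(n-k) S2(n,k) t^n/n!, gives the formula.

    The proof compares coefficients. Both g = e^t - 1 (with c = 0) and g = L
    (with c = 1) satisfy (1 - c t) g' = 1 + g. As (1 - c t) d/dt is a derivation,
    (1 - c t) (g^(m+1))' = (m+1) (g^m + g^(m+1)), so that n! [t^n] g^m = m! T_c(n,m)
    where T_c is the array [triangle c] with T_c(0,0) = 1 and
      T_c(n+1,m+1) = T_c(n,m) + (m+1 + c n) T_c(n,m+1)
    ([fps_pow_triangle]). Here T_0 consists of the Stirling numbers of the second
    kind, also in their combinatorial definition ([stirling2_triangle]), and
    T_1 of the unsigned Lah numbers. Hence the degenerate Bell and Lah-Bell
    polynomials are the combinations of the (x)_{m,lambda} with coefficients
    T_0(n,m) and T_1(n,m), and the theorem reduces to the numerical identity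
    \sum_k (-1)^(n+k) T_0(n,k) T_1(k,m) = T_0(n,m) ([triangle_inversion]). *)

(** * The common recurrence of Stirling and Lah numbers *)

(** Stirling numbers of the second kind for c = 0, unsigned Lah numbers for
    c = 1. *)
Fixpoint triangle (c n m : nat) : nat :=
  match n, m with
  | 0, 0 => 1
  | n'.+1, m'.+1 => (triangle c n' m' + (m + c * n') * triangle c n' m)%N
  | _, _ => 0
  end.

Lemma triangle_gt c n m : (n < m)%N -> triangle c n m = 0%N.
Proof.
elim: n m => [|n IHn] [|m] //= lt_nm.
by rewrite !IHn ?muln0 // (ltnW lt_nm).
Qed.

(** * Counting set partitions *)

Section SetPartitions.
Variable T : finType.
Implicit Types (D E B C : {set T}) (P Q : {set {set T}}).

Definition partitions D k := [set P | partition P D & #|P| == k].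

(** A partition of x |: E either has [set x] as a block, which can be deleted,
    or arises from a partition of E by adding x to one of its blocks. *)
Section AddPoint.
Variables (x : T) (E : {set T}) (k : nat).
Hypothesis xE : x \notin E.

Let part_notin Q B : partition Q E -> B \in Q -> x \notin B.
Proof.
by move=> pQ QB; apply: contra xE; apply: (subsetP (partitionS pQ QB)).
Qed.

Lemma card_partitions_singleton :
  #|[set P in partitions (x |: E) k.+1 | [set x] \in P]| = #|partitions E k|.
Proof.
have x1n Q : Q \in partitions E k -> [set x] \notin Q.
  rewrite inE => /andP[pQ _]; apply/negP => /(part_notin _ _ pQ).
  by rewrite set11.
rewrite -(@card_in_imset _ _ (fun Q => [set x] |: Q) (partitions E k)).
  apply: eq_card => P; rewrite !inE; apply/idP/imsetP => [|[Q EkQ ->]].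
    case/andP=> /andP[pP cP] xP; exists (P :\ [set x]); last by rewrite setD1K.
    rewrite inE; have := partitionD1 pP xP; rewrite setU1K // => ->.
    by move: cP; rewrite (cardsD1 [set x]) xP.
  have := x1n _ EkQ; move: EkQ; rewrite inE => /andP[pQ /eqP cQ] xQ.
  rewrite setU11 cardsU1 xQ cQ eqxx !andbT partitionU1 //.
    by apply/set0Pn; exists x; rewrite set11.
  by rewrite disjoints1.
move=> Q1 Q2 EQ1 EQ2 /= eqQ.
by rewrite -(setU1K (x1n _ EQ1)) eqQ setU1K ?x1n.
Qed.

(* [insert] adds x to the block u.2 of the partition u.1; [delete] removes x from
   its block and remembers which block that was. *)
Let insert (u : {set {set T}} * {set T}) := (x |: u.2) |: (u.1 :\ u.2).
Let delete P := let C := pblock P x in (C :\ x |: P :\ C, C :\ x).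
Let pointed := [set u : {set {set T}} * {set T} |
  (u.1 \in partitions E k.+1) && (u.2 \in u.1)].

Let card_pointed : #|pointed| = k.+1 * #|partitions E k.+1|.
Proof.
rewrite -sum1_card (eq_bigl (fun u => (u.1 \in partitions E k.+1) && (u.2 \in u.1))).
  rewrite -(pair_big_dep (fun Q => Q \in partitions E k.+1)
    (fun Q B => B \in Q) (fun _ _ => 1)) /=.
  rewrite mulnC -sum_nat_const; apply: eq_bigr => Q.
  by rewrite inE sum1_card => /andP[_ /eqP].
move=> u. by rewrite inE.
Qed.

Let insert_partition u : u \in pointed ->
  [/\ partition (insert u) (x |: E), #|insert u| = k.+1,
      [set x] \notin insert u & delete (insert u) = u].
Proof.
case: u => Q B; rewrite !inE /= => /andP[/andP[pQ /eqP cQ] QB].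
have xB := part_notin _ _ pQ QB.
have nC : x |: B \notin Q :\ B.
  rewrite inE negb_and; apply/orP; right.
  by apply/negP => /(part_notin _ _ pQ); rewrite setU11.
have pI : partition (insert (Q, B)) (x |: E).
  have -> : x |: E = (x |: B) :|: (E :\: B).
    by rewrite -{1}(setID E B) (setIidPr (partitionS pQ QB)) setUA.
  apply: partitionU1; first exact: partitionD1.
    by apply/set0Pn; exists x; rewrite setU11.
  rewrite -setI_eq0; apply/eqP/setP => y; rewrite !inE.
  by case: eqP => [->|_]; rewrite ?(negbTE xE) ?andbF //=; case: (y \in B).
split=> //.
- by rewrite /insert /= cardsU1 nC /= -cQ (cardsD1 B Q) QB.
- rewrite negb_or negb_and; apply/andP; split; last first.
    by apply/orP; right; apply/negP => /(part_notin _ _ pQ); rewrite set11.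
  have /set0Pn[y yB] := partition_neq0 pQ QB.
  apply/eqP => /setP/(_ y); rewrite !inE yB orbT => /eqP eyx.
  by rewrite -eyx yB in xB.
have -> : delete (insert (Q, B)) =
          ((x |: B) :\ x |: insert (Q, B) :\ (x |: B), (x |: B) :\ x).
  rewrite /delete (@def_pblock _ _ (x |: B)) ?setU11 //.
  exact: partition_trivIset pI.
by rewrite /insert /= !setU1K // setD1K.
Qed.

Let delete_partition P : P \in partitions (x |: E) k.+1 -> [set x] \notin P ->
  delete P \in pointed /\ insert (delete P) = P.
Proof.
rewrite inE => /andP[pP /eqP cP] x1P.
have xcov : x \in cover P by rewrite (cover_partition pP) setU11.
have PC := pblock_mem xcov; have xC : x \in pblock P x by rewrite mem_pblock.
rewrite /delete; set C := pblock P x in PC xC *.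
have C0 : C :\ x != set0.
  apply: contra x1P => /eqP Cx0.
  by rewrite -[[set x]]setU0 -Cx0 setD1K.
have defE : (C :\ x) :|: ((x |: E) :\: C) = E.
  apply/setP => y; rewrite !inE; have := subsetP (partitionS pP PC) y.
  rewrite !inE; case: eqP => [->|_] /=; first by rewrite xC (negbTE xE).
  by case: (y \in C) => //= ->.
have nP : C :\ x \notin P :\ C.
  rewrite inE negb_and; apply/orP; right; apply/negP => PCx.
  have /set0Pn[y yCx] := C0; have yC : y \in C by case/setD1P: yCx.
  have tP := partition_trivIset pP.
  have := def_pblock tP PCx yCx; rewrite (def_pblock tP PC yC) => eC.
  by move: xC; rewrite eC setD11.
split; last by rewrite /insert /= setU1K // !setD1K.
rewrite !inE /= eqxx andbT; apply/andP; split.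
  rewrite -[X in partition _ X]defE; apply: partitionU1 => //.
    exact: partitionD1.
  rewrite -setI_eq0; apply/eqP/setP => y; rewrite !inE.
  by case: (y \in C); rewrite ?andbF.
by rewrite cardsU1 nP; move: cP; rewrite (cardsD1 C) PC => ->.
Qed.

Lemma card_partitions_not_singleton :
  #|[set P in partitions (x |: E) k.+1 | [set x] \notin P]|
  = k.+1 * #|partitions E k.+1|.
Proof.
rewrite -card_pointed -(@card_in_imset _ _ insert pointed).
  apply: eq_card => P; rewrite inE; apply/andP/imsetP => [[DP xP]|[u Uu ->]].
    by have [Ud Id] := delete_partition _ DP xP; exists (delete P).
  by have [pI cI xI _] := insert_partition _ Uu; rewrite inE pI cI eqxx.
move=> u v Uu Uv eq_uv.
have [_ _ _ <-] := insert_partition _ Uu; rewrite eq_uv.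
by have [_ _ _ ->] := insert_partition _ Uv.
Qed.

Lemma card_partitionsU1 : #|partitions (x |: E) k.+1| =
  #|partitions E k| + k.+1 * #|partitions E k.+1|.
Proof.
rewrite -card_partitions_singleton -card_partitions_not_singleton.
rewrite -(cardsID [set P : {set {set T}} | [set x] \in P]); congr (_ + _).
  by apply: eq_card => P; rewrite !inE.
by apply: eq_card => P; rewrite !inE andbC.
Qed.
End AddPoint.
End SetPartitions.

(** Induction on the size of D: removing a point of D turns the recurrence of
    [card_partitionsU1] into that of the array for c = 0. *)
Lemma card_partitions (T : finType) (D : {set T}) k :
  #|partitions _ D k| = triangle 0 #|D| k.
Proof.
move cD: #|D| => n; elim: n D cD k => [|n IHn] D cD k.
  have -> : D = set0 by apply/eqP; rewrite -cards_eq0 cD.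
  case: k => [|k] /=.
    rewrite (_ : partitions _ set0 0 = [set set0]) ?cards1 //.
    apply/setP => P; rewrite !inE partition_set0.
    by case: eqP => // ->; rewrite cards0.
  apply: eq_card0 => P; rewrite inE partition_set0.
  by case: eqP => // ->; rewrite cards0.
have /card_gt0P[x xD] : (0 < #|D|)%N by rewrite cD.
case: k => [|k].
  apply: eq_card0 => P; rewrite inE cards_eq0; apply/negbTE/negP.
  case/andP=> pP /eqP P0; move: xD.
  by rewrite -(cover_partition pP) P0 /cover big_set0 inE.
have xE : x \notin D :\ x by rewrite setD11.
have cE : #|D :\ x| = n by move: cD; rewrite (cardsD1 x) xD => -[].
rewrite -{1}(setD1K xD) card_partitionsU1 // !IHn //=.
by rewrite mul0n addn0.
Qed.

Local Open Scope ring_scope.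

Lemma stirling2_triangle n k : stirling2 n k = triangle 0 n k.
Proof. by rewrite -[n in RHS]card_ord -cardsT -card_partitions. Qed.

(** * Powers of a series with (1 - c t) g' = 1 + g *)

Section Derivation.
Variable A : comNzRingType.
Implicit Types f g : fps A.

(** The operator (1 - c t) d/dt. *)
Definition fps_derivation (c : nat) f : fps A :=
  fun n => n.+1%:R * f n.+1 - (c * n)%:R * f n.

(** Leibniz rule: both d/dt and t d/dt are derivations, the former by writing
    n+1 = i + (n+1-i) and the latter by writing n = i + (n-i). *)
Lemma fps_derivation_mul c f g n :
  fps_derivation c (fps_mul f g) n =
  fps_mul (fps_derivation c f) g n + fps_mul f (fps_derivation c g) n.
Proof.
have Dsum : n.+1%:R * fps_mul f g n.+1 =
    \sum_(i < n.+1) i.+1%:R * f i.+1 * g (n - i)%N +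
    \sum_(i < n.+1) f i * ((n - i).+1%:R * g (n - i).+1).
  pose F i := i%:R * f i * g (n.+1 - i)%N.
  pose G i := f i * ((n.+1 - i)%:R * g (n.+1 - i)%N).
  transitivity (\sum_(i < n.+2) F i + \sum_(i < n.+2) G i).
    rewrite /fps_mul mulr_sumr -big_split; apply: eq_bigr => i _.
    have le_in : (i <= n.+1)%N by rewrite -ltnS.
    by rewrite /F /G /= natrB //; ring.
  rewrite big_ord_recl /F mul0r mul0r add0r; congr (_ + _).
  rewrite big_ord_recr /G /= subnn mul0r mulr0 addr0.
  by apply: eq_bigr => i _; rewrite subSn // -ltnS.
have Tsum : (c * n)%:R * fps_mul f g n =
    \sum_(i < n.+1) (c * i)%:R * f i * g (n - i)%N +
    \sum_(i < n.+1) f i * ((c * (n - i))%:R * g (n - i)%N).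
  rewrite /fps_mul mulr_sumr -big_split; apply: eq_bigr => i _.
  have le_in : (i <= n)%N by rewrite -ltnS.
  by rewrite /= !natrM natrB //; ring.
rewrite /fps_derivation Dsum Tsum opprD addrACA /fps_mul -!sumrB.
by congr (_ + _); apply: eq_bigr => i _; rewrite ?mulrBl ?mulrBr.
Qed.

Lemma fps_mul1 f n : fps_mul (fps_const 1) f n = f n.
Proof.
rewrite /fps_mul big_ord_recl /= mul1r subn0 big1 ?addr0 // => i _.
by rewrite /fps_const /= mul0r.
Qed.

(** Induction on m with the Leibniz rule, using only the distributivity of the
    product of series: (1+g) g^(m+1) + g (m+1) (g^m + g^(m+1))
    = (m+2) (g^(m+1) + g^(m+2)). *)
Lemma fps_derivation_pow c g : fps_derivation c g =1 (fun n => fps_const 1 n + g n) ->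
  forall m n, fps_derivation c (fps_pow g m.+1) n =
    m.+1%:R * (fps_pow g m n + fps_pow g m.+1 n).
Proof.
move=> Dg; have powS j : fps_pow g j.+1 = fps_mul g (fps_pow g j) by [].
have Dmul h n : fps_mul (fps_derivation c g) h n = h n + fps_mul g h n.
  rewrite -[h n in RHS]fps_mul1 /fps_mul -big_split.
  by apply: eq_bigr => i _; rewrite /= Dg mulrDl.
elim=> [|m IHm] n; rewrite powS fps_derivation_mul Dmul.
  rewrite mul1r -[RHS]addr0; congr (_ + _).
  rewrite /fps_mul big1 // => i _.
  by rewrite /fps_derivation /fps_pow /fps_const /=; case: (n - i)%N => [|j] /=;
    rewrite ?muln0 ?mul0r ?mulr0 ?subr0 ?mulr0.
have -> : fps_mul g (fps_derivation c (fps_pow g m.+1)) n =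
    m.+1%:R * (fps_pow g m.+1 n + fps_mul g (fps_pow g m.+1) n).
  rewrite {2}powS /fps_mul -big_split mulr_sumr.
  by apply: eq_bigr => i _; rewrite IHm /fps_mul /=; ring.
by rewrite -[m.+2]addn1 natrD; ring.
Qed.

(** Comparing the coefficients of t^n in [fps_derivation_pow] yields
    (n+1) [t^(n+1)] g^(m+1) = (m+1) [t^n] g^m + (m+1 + c n) [t^n] g^(m+1), the
    recurrence of the array up to factorials. *)
Lemma fps_pow_triangle c g : g 0%N = 0 ->
    fps_derivation c g =1 (fun n => fps_const 1 n + g n) ->
  forall n m, n`!%:R * fps_pow g m n = (m`! * triangle c n m)%:R.
Proof.
move=> g0 Dg; elim=> [|n IHn] [|m].
- by rewrite mul1r.
- by rewrite [triangle _ _ _]/= muln0 fps_pow_ord ?mulr0.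
- by rewrite /fps_pow /fps_const /= mulr0.
have := fps_derivation_pow _ _ Dg m n; rewrite /fps_derivation => /(canRL (subrK _)) D.
rewrite factS mulnC natrM -mulrA D.
rewrite !mulrDr !mulrA ![n`!%:R * _]mulrC -!mulrA !IHn.
rewrite factS !natrM !natrD !natrM natrD natrM; ring.
Qed.
End Derivation.

(** * Passing from Lah to Stirling numbers *)

(** Coefficient form of e^t - 1 = L(1 - e^(-t)). Applying the recurrence of T_0
    to the first factor and that of T_1 to the second, the k-th summand acquires
    the factor -k from the former and k + m + 1 from the latter; they add up to
    m + 1, which leaves the recurrence of T_0. *)
Lemma triangle_inversion (A : comNzRingType) n m :
  \sum_(k < n.+1) (-1) ^+ (n + k) * (triangle 0 n k * triangle 1 k m)%:R
    = (triangle 0 n m)%:R :> A.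
Proof.
elim: n m => [|n IHn] m.
  by rewrite big_ord_recl big_ord0 addr0 mul1r mul1n; case: m.
case: m => [|m].
  by rewrite big1 // => -[[|k] ltk] _; rewrite ?muln0 mulr0.
rewrite big_ord_recl mul0n mulr0 add0r.
(* F k carries the factor k of the recurrence of T_0; it vanishes at k = 0 and
   k = n+1, so its sum is invariant under the index shift. *)
pose F k : A := (-1) ^+ (n + k) * (k * triangle 0 n k * triangle 1 k m.+1)%:R.
have shiftF : \sum_(k < n.+1) F k.+1 = \sum_(k < n.+1) F k.
  have F0 : F 0%N = 0 by rewrite /F !mul0n mulr0.
  have Fn : F n.+1 = 0 by rewrite /F (triangle_gt 0 n n.+1) // muln0 mul0n mulr0.
  transitivity (\sum_(k < n.+2) F k).
    by rewrite [RHS]big_ord_recl F0 add0r.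
  by rewrite big_ord_recr /= Fn addr0.
transitivity (\sum_(k < n.+1)
    ((-1) ^+ (n + k) * (triangle 0 n k * triangle 1 k.+1 m.+1)%:R - F k.+1)).
  apply: eq_bigr => k _; rewrite lift0 /F.
  have -> : triangle 0 n.+1 k.+1 =
      (triangle 0 n k + k.+1 * triangle 0 n k.+1)%N by rewrite /= mul0n addn0.
  by rewrite !addnS addSn !exprS !natrM natrD natrM; ring.
rewrite sumrB shiftF -sumrB.
rewrite [triangle 0 n.+1 m.+1]/= natrD mul0n addn0 natrM -!IHn mulr_sumr -big_split.
apply: eq_bigr => k _; rewrite /F /= !(natrM, natrD); ring.
Qed.

(** * Expansions in degenerate falling factorials *)

Section FallingExpansions.
Variables (R : realType) (lambda : R).

Lemma degenerate_comp_triangle c (g : fps {poly R}) n : g 0%N = 0 ->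
    fps_derivation _ c g =1 (fun n => fps_const 1 n + g n) ->
  n`!%:R *: fps_comp (degenerate_exp lambda) g n =
  \sum_(m < n.+1) (triangle c n m)%:R *: degenerate_falling lambda m.
Proof.
move=> g0 Dg; rewrite /fps_comp scaler_sumr; apply: eq_bigr => m _.
have gE : n`!%:R *: fps_pow g m n = (m`! * triangle c n m)%:R.
  by rewrite scaler_nat -(fps_pow_triangle _ _ _ g0 Dg) mulr_natl.
rewrite scalerAr gE.
rewrite [RHS]scaler_nat mulr_natr mulrnA; congr (_ *+ _).
by rewrite -scaler_nat /degenerate_exp /egf scalerA divff ?scale1r //
  pnatr_eq0 -lt0n fact_gt0.
Qed.

Lemma bell_inner_deriv :
  fps_derivation _ 0 (fps_sub (fps_exp R) (fps_const 1)) =1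
    (fun n => fps_const 1 n + fps_sub (fps_exp R) (fps_const 1) n).
Proof.
move=> n; rewrite /fps_derivation mul0n mul0r subr0 /fps_sub /fps_exp /egf.
rewrite [RHS]addrC subrK.
rewrite /fps_const subr0 factS mulr_natl -scaler_nat scalerA.
by rewrite natrM invfM mulrA divff ?mul1r // pnatr_eq0.
Qed.

Lemma lah_bell_inner_deriv :
  fps_derivation _ 1 (fps_sub (fps_geom {poly R}) (fps_const 1)) =1
    (fun n => fps_const 1 n + fps_sub (fps_geom {poly R}) (fps_const 1) n).
Proof.
move=> [|n]; rewrite /fps_derivation /fps_sub /fps_geom /fps_const /= ?subr0 ?mulr1.
  by rewrite subrr mulr0 subr0 addr0.
by rewrite mul1n -natrB // subSnn add0r.
Qed.

Lemma bellE n : degenerate_bell lambda n =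
  \sum_(m < n.+1) (triangle 0 n m)%:R *: degenerate_falling lambda m.
Proof.
exact: degenerate_comp_triangle (bell_inner0 R) bell_inner_deriv.
Qed.

(** The range N independent of n makes these expansions summable over n in the
    theorem; the terms with m > n vanish. *)
Lemma lah_bellE N n : (n <= N)%N -> degenerate_lah_bell lambda n =
  \sum_(m < N.+1) (triangle 1 n m)%:R *: degenerate_falling lambda m.
Proof.
move=> le_nN; rewrite /degenerate_lah_bell.
rewrite (degenerate_comp_triangle _ _ _ (lah_bell_inner0 R) lah_bell_inner_deriv).
pose F m := (triangle 1 n m)%:R *: degenerate_falling lambda m.
rewrite (big_ord_widen _ F (le_nN : n < N.+1)%N).
rewrite big_mkcond; apply: eq_bigr => m _.
by case: ltnP => // lt_nm; rewrite /F triangle_gt // scale0r.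
Qed.
End FallingExpansions.

Theorem mainTheorem14 (R : realType) (lambda : R) (hlambda : lambda != 0)
    (n : nat) :
  degenerate_bell lambda n =
  \sum_(k < n.+1)
     ((-1) ^+ (n - k) * (stirling2 n k)%:R) *: degenerate_lah_bell lambda k.
Proof.
rewrite bellE; symmetry.
under eq_bigr => k _.
  rewrite (lah_bellE _ _ _ _ (ltn_ord k : (k <= n)%N)) scaler_sumr; over.
rewrite exchange_big; apply: eq_bigr => m _ /=.
rewrite -triangle_inversion scaler_suml; apply: eq_bigr => k _.
have le_kn : (k <= n)%N by rewrite -ltnS.
rewrite scalerA stirling2_triangle -mulrA -natrM; congr (_ * _ *: _).
by rewrite -[in LHS]signr_odd oddB // -oddD signr_odd.
Qed.
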